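(* Assume $\operatorname{rank}(V_{N,r})=R$ and $\operatorname{rank}(V_{M,r})=M$, let $f:\mathbb{S}^2\to\mathbb{R}$, and let $\hat p_r[f]\in\Pi_r(\mathbb{S}^2)$ be the interpolation--regression approximant of $f$. Then: (i) The residual $\hat p_r[f]-f$ is orthogonal to $\mathcal{V}_{r,M}$ with respect to $\langle\cdot,\cdot\rangle_{X_N}$, namely $$\langle \hat p_r[f]-f,\,q\rangle_{X_N}=0\qquad\text{for all } q\in\mathcal{V}_{r,M}.$$ (ii) $\hat p_r[f]$ is the unique element $p$ of $\mathcal{A}_{r,M}(f)$ satisfying $$\langle p-f,\,q\rangle_{X_N}=0\qquad\text{for all } q\in\mathcal{V}_{r,M}.$$
   Context: $\Pi_r(\mathbb{S}^2)$ is the space of spherical polynomials of degree at most $r$ on the unit sphere $\mathbb{S}^2\subset\mathbb{R}^3$, of dimension $R=(r+1)^2$. $X_N=\{\boldsymbol{x}_1,\dots,\boldsymbol{x}_N\}\subset\mathbb{S}^2$ is a set of $N$ distinct sampling nodes and $X_M=\{\boldsymbol{x}_1',\dots,\boldsymbol{x}_M'\}\subset X_N$ a subset of $M$ distinct interpolation nodes. Conventions: $N=(n+1)^2$, $M=(m+1)^2$, with integers $0\le m<r<n$. For a fixed basis $\{b_1,\dots,b_R\}$ of $\Pi_r(\mathbb{S}^2)$, $V_{N,r}=[b_j(\boldsymbol{x}_i)]\in\mathbb{R}^{N\times R}$ and $V_{M,r}=[b_j(\boldsymbol{x}_i')]\in\mathbb{R}^{M\times R}$. For $f:\mathbb{S}^2\to\mathbb{R}$,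 the interpolation--regression approximant $\hat p_r[f]$ is the (under the rank assumptions, unique) minimizer of $\sum_{i=1}^N|p(\boldsymbol{x}_i)-f(\boldsymbol{x}_i)|^2$ over all $p\in\Pi_r(\mathbb{S}^2)$ subject to $p(\boldsymbol{x}_j')=f(\boldsymbol{x}_j')$, $j=1,\dots,M$. Notation: $\langle p,q\rangle_{X_N}=\sum_{i=1}^N p(\boldsymbol{x}_i)q(\boldsymbol{x}_i)$ for real functions $p,q$ defined on $X_N$; $\mathcal{V}_{r,M}=\{q\in\Pi_r(\mathbb{S}^2): q(\boldsymbol{x}_j')=0,\ j=1,\dots,M\}$; $\mathcal{A}_{r,M}(f)=\{p\in\Pi_r(\mathbb{S}^2): p(\boldsymbol{x}_j')=f(\boldsymbol{x}_j'),\ j=1,\dots,M\}$. *)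

(* Defs.v *)
From mathcomp Require Import all_boot all_order all_algebra.
From mathcomp Require Import mpoly.
From mathcomp Require Import boolp classical_sets functions reals.

Set Implicit Arguments.
Unset Strict Implicit.
Unset Printing Implicit Defensive.

Import Order.TTheory GRing.Theory Num.Theory.

Local Open Scope classical_set_scope.
Local Open Scope ring_scope.

Definition sphere (R : realType) : Type :=
  {x : 'rV[R]_3 | \sum_(i < 3) x 0 i ^+ 2 == 1}.

(* [msize P] is the total degree plus one ([msize 0 = 0]). *)
Definition sph_poly (R : realType) (r : nat) : set (sphere R -> R) :=
  [set p | exists2 P : {mpoly R[3]}, (msize P <= r.+1)%N &
             forall x : sphere R, p x = P.@[fun i => val x 0 i]].

Definition is_basis (R : realType) (D : nat) (b : 'I_D -> sphere R -> R)
    (E : set (sphere R -> R)) : Prop :=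
  [/\ forall j, E (b j),
      forall c : 'I_D -> R,
        (forall z, \sum_(j < D) c j * b j z = 0) -> forall j, c j = 0
    & forall p, E p ->
        exists c : 'I_D -> R, forall z, p z = \sum_(j < D) c j * b j z].

Definition vdm (R : realType) (K D : nat) (x : 'I_K -> sphere R)
    (b : 'I_D -> sphere R -> R) : 'M[R]_(K, D) :=
  \matrix_(i < K, j < D) b j (x i).

Definition node_dot (R : realType) (N : nat) (x : 'I_N -> sphere R)
    (p q : sphere R -> R) : R :=
  \sum_(i < N) p (x i) * q (x i).

Definition vanishing (R : realType) (r M : nat) (y : 'I_M -> sphere R) :
    set (sphere R -> R) :=
  [set q | sph_poly r q /\ forall j, q (y j) = 0].

Definition interpolating (R : realType) (r M : nat) (y : 'I_M -> sphere R)
    (f : sphere R -> R) : set (sphere R -> R) :=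
  [set p | sph_poly r p /\ forall j, p (y j) = f (y j)].

Definition is_constrained_minimizer (R : realType) (r N M : nat)
    (x : 'I_N -> sphere R) (y : 'I_M -> sphere R) (f p : sphere R -> R) : Prop :=
  interpolating r y f p /\
  forall p', interpolating r y f p' ->
    \sum_(i < N) `|p (x i) - f (x i)| ^+ 2 <=
    \sum_(i < N) `|p' (x i) - f (x i)| ^+ 2.

(* Definite description: the unique minimizer if there is exactly one, and the
   junk value 0 otherwise.  Existence and uniqueness are thus not built in, but
   must be derived from the rank assumptions wherever they are needed. *)
Definition interp_regr (R : realType) (r N M : nat)
    (x : 'I_N -> sphere R) (y : 'I_M -> sphere R) (f : sphere R -> R) :
    sphere R -> R :=
  xget 0 [set p | unique (is_constrained_minimizer r x y f) p].

(* Main.v *)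
(* An interpolant p0 whose residual is orthogonal to the vanishing polynomials
   exists: in coordinates this amounts to solving u W W^T = h W^T, which is
   always possible since W W^T and W^T have the same row space over an ordered
   field.  By Pythagoras, every interpolant p satisfies
   |p - f|^2 = |p0 - f|^2 + |p - p0|^2 on the nodes, so such a p0 minimizes, and
   the rank of V_{N,r} makes it the only minimizer.  Hence orthogonality
   characterizes the approximant. *)
Require Import Defs.
From mathcomp Require Import all_boot all_order all_algebra.
From mathcomp Require Import mpoly.
From mathcomp Require Import boolp classical_sets functions reals.
From mathcomp Require Import ring.

Import Order.TTheory GRing.Theory Num.Theory.
Local Open Scope ring_scope.

Lemma mulmx_tr_self_eq0 (F : realFieldType) (k : nat) (v : 'rV[F]_k) :
  v *m v^T = 0 -> v = 0.
Proof.
move=> /matrixP /(_ 0 0); rewrite !mxE => /eqP.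
rewrite psumr_eq0 => [/allP v0|j _]; last by rewrite mxE -expr2 sqr_ge0.
apply/rowP => j; have := v0 j (mem_index_enum _).
by rewrite !mxE -expr2 sqrf_eq0 => /eqP.
Qed.

(** If [v W W^T = 0], then [(v W) (v W)^T = 0], a vanishing sum of squares, so [v W = 0]. Hence
    [W W^T] and [W] have the same left kernel and the same rank. *)
Lemma gram_row_space (F : realFieldType) (k l : nat) (W : 'M[F]_(k, l)) :
  (W^T <= W *m W^T)%MS.
Proof.
have ker_sub : (kermx (W *m W^T) <= kermx W)%MS.
  apply/rV_subP => v /sub_kermxP vWW; apply/sub_kermxP.
  by apply: mulmx_tr_self_eq0; rewrite trmx_mul mulmxA -(mulmxA v) vWW mul0mx.
(* The opposite inclusion always holds, so it suffices to compare ranks, which rank-nullity reads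
   off the kernels. *)
rewrite -(geq_leqif (mxrank_leqif_sup (submxMl W W^T))) mxrank_tr.
have := leq_sub2l k (mxrankS ker_sub).
by rewrite !mxrank_ker !subKn ?rank_leq_row.
Qed.

(** Coefficients are row vectors, so [A] and [B] stand for the transposes of V_{N,r} and V_{M,r},
    while [f] and [g] are the data at the two sets of nodes. *)
Lemma constrained_normal_eq_solvable (F : realFieldType) (D N M : nat)
    (A : 'M[F]_(D, N)) (B : 'M[F]_(D, M)) (f : 'rV[F]_N) (g : 'rV[F]_M) :
  row_full B ->
  exists2 c : 'rV[F]_D, c *m B = g &
    forall d : 'rV[F]_D, d *m B = 0 -> (c *m A - f) *m (d *m A)^T = 0.
Proof.
move=> fullB; have /submxP[c0 gE] : (g <= B)%MS by apply: submx_full.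
(* The rows of [W] span the vectors [d *m A] with [d *m B = 0], so orthogonality to all of them is
   one equation against [W^T]. The unknown [u] corrects the particular solution [c0] inside
   [kermx B]. *)
set W := kermx B *m A.
have /submxP[u uE] : ((f - c0 *m A) *m W^T <= W *m W^T)%MS.
  exact: submx_trans (submxMl _ _) (gram_row_space _ _ _ W).
exists (c0 + u *m kermx B).
  by rewrite mulmxDl -mulmxA mulmx_ker mulmx0 addr0.
move=> d /sub_kermxP /submxP[e ->].
rewrite -(mulmxA e) -/W trmx_mul mulmxA (mulmxDl c0) -(mulmxA u) -/W.
rewrite (_ : (_ - f) *m W^T = 0) ?mul0mx //.
by rewrite addrAC mulmxDl -mulmxA -uE -mulmxDl -(opprB f) addNr mul0mx.
Qed.

Section SphericalPolynomials.
Variables (R : realType) (r : nat).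

Lemma sph_polyD (p q : sphere R -> R) :
  sph_poly r p -> sph_poly r q -> sph_poly r (p + q).
Proof.
move=> [P szP pE] [Q szQ qE]; exists (P + Q) => [|z].
  by rewrite (leq_trans (msizeD_le _ _)) // geq_max szP.
by rewrite mevalD -pE -qE.
Qed.

Lemma sph_polyZ (a : R) (p : sphere R -> R) :
  sph_poly r p -> sph_poly r (fun z => a * p z).
Proof.
move=> [P szP pE]; exists (a *: P) => [|z].
  exact: leq_trans (msizeZ_le _ _) szP.
by rewrite mevalZ -pE.
Qed.

Lemma sph_polyB (p q : sphere R -> R) :
  sph_poly r p -> sph_poly r q -> sph_poly r (p - q).
Proof.
move=> pr qr; apply: sph_polyD => //.
rewrite (_ : - q = fun z => -1 * q z); first exact: sph_polyZ.
by apply/funext => z; rewrite mulN1r.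
Qed.

Lemma sph_poly_lin_comb (D : nat) (c : 'I_D -> R) (b : 'I_D -> sphere R -> R) :
  (forall j, sph_poly r (b j)) ->
  sph_poly r (fun z => \sum_(j < D) c j * b j z).
Proof.
move=> br.
rewrite (_ : (fun z => _) = \sum_(j < D) (fun z => c j * b j z)).
  apply: big_ind => [|p q|j _].
  - by exists 0 => [|z]; rewrite ?msize0 // meval0.
  - exact: sph_polyD.
  - exact: sph_polyZ.
by apply/funext => z; rewrite fct_sumE.
Qed.

Lemma interpolatingB (M : nat) (y : 'I_M -> sphere R) (f p q : sphere R -> R) :
  interpolating r y f p -> interpolating r y f q -> vanishing r y (p - q).
Proof.
move=> [pr pf] [qr qf]; split; first exact: sph_polyB.
by move=> j; rewrite !fctE pf qf subrr.
Qed.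

Lemma vdm_lin_comb (K D : nat) (x : 'I_K -> sphere R)
    (b : 'I_D -> sphere R -> R) (c : 'rV[R]_D) (i : 'I_K) :
  (c *m (vdm x b)^T) 0 i = \sum_(j < D) c 0 j * b j (x i).
Proof. by rewrite mxE; apply: eq_bigr => j _; rewrite !mxE. Qed.

Section Nodes.
Variables (N D : nat) (x : 'I_N -> sphere R) (b : 'I_D -> sphere R -> R).
Hypothesis b_basis : is_basis b (sph_poly r).

Lemma sph_poly_coord (p : sphere R -> R) : sph_poly r p ->
  exists c : 'rV[R]_D, forall z, p z = \sum_(j < D) c 0 j * b j z.
Proof.
case: b_basis => _ _ gen /gen[c pE]; exists (\row_j c j) => z.
by rewrite pE; apply: eq_bigr => j _; rewrite mxE.
Qed.

(** Full column rank means that the values at the nodes determine the coefficients. *)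
Lemma sph_poly_eq0_on_nodes (q : sphere R -> R) : \rank (vdm x b) = D ->
  sph_poly r q -> (forall i, q (x i) = 0) -> q = 0.
Proof.
move=> rk /sph_poly_coord[c qE] q0.
have free : row_free (vdm x b)^T by rewrite /row_free mxrank_tr rk.
have c0 : c = 0.
  apply: (row_free_inj free); rewrite mul0mx; apply/rowP => i.
  by rewrite vdm_lin_comb -qE q0 mxE.
by apply/funext => z; rewrite qE c0 big1 // => j _; rewrite mxE mul0r.
Qed.

Lemma interpolating_orthogonal_exists (M : nat) (y : 'I_M -> sphere R)
    (f : sphere R -> R) : \rank (vdm y b) = M ->
  exists2 p, interpolating r y f p &
    forall q, vanishing r y q -> node_dot x (p - f) q = 0.
Proof.
move=> rk.
(* Rank [M] makes the interpolation conditions solvable for arbitrary data. *)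
have full : row_full (vdm y b)^T by rewrite /row_full mxrank_tr rk.
have [c cB orth] := constrained_normal_eq_solvable _ _ _ _ (vdm x b)^T _
  (\row_i f (x i)) (\row_j f (y j)) full.
exists (fun z => \sum_(j < D) c 0 j * b j z).
  split; first by apply: sph_poly_lin_comb; case: b_basis.
  by move=> j /=; rewrite -(vdm_lin_comb _ _ y b) cB mxE.
move=> q [/sph_poly_coord[d qE] q0].
have /orth /matrixP /(_ 0 0) : d *m (vdm y b)^T = 0.
  by apply/rowP => j; rewrite vdm_lin_comb -qE q0 mxE.
rewrite [LHS]mxE [RHS]mxE; apply: etrans; apply: eq_bigr => i _.
rewrite qE -!(vdm_lin_comb _ _ x b) [X in _ = _ * X]mxE.
by congr (_ * _); rewrite [RHS]mxE vdm_lin_comb; congr (_ + _); rewrite !mxE.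
Qed.

End Nodes.

Lemma node_dot_pythagoras (N : nat) (x : 'I_N -> sphere R)
    (f p p' : sphere R -> R) : node_dot x (p - f) (p' - p) = 0 ->
  \sum_(i < N) `|p' (x i) - f (x i)| ^+ 2 =
  \sum_(i < N) `|p (x i) - f (x i)| ^+ 2 +
  \sum_(i < N) (p' (x i) - p (x i)) ^+ 2.
Proof.
move=> orth.
transitivity (\sum_(i < N) (`|p (x i) - f (x i)| ^+ 2 +
    ((p' (x i) - p (x i)) ^+ 2 + (p - f) (x i) * (p' - p) (x i) *+ 2))).
  apply: eq_bigr => i _; rewrite !real_normK ?num_real // !fctE.
  by ring.
by rewrite !big_split /= -/(node_dot _ _ _) orth !addr0.
Qed.

Lemma orthogonal_unique_minimizer (N M D : nat) (x : 'I_N -> sphere R)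
    (y : 'I_M -> sphere R) (b : 'I_D -> sphere R -> R) (f p : sphere R -> R) :
  is_basis b (sph_poly r) -> \rank (vdm x b) = D ->
  interpolating r y f p ->
  (forall q, vanishing r y q -> node_dot x (p - f) q = 0) ->
  unique (is_constrained_minimizer r x y f) p.
Proof.
move=> b_basis rk pA orth.
(* Two interpolants differ by a vanishing polynomial, so [orth] applies to [p' - p]. *)
have pyth p' : interpolating r y f p' -> _ := fun p'A =>
  node_dot_pythagoras _ _ _ _ _ (orth _ (interpolatingB _ _ _ _ _ p'A pA)).
split.
  split=> // p' /pyth ->; rewrite lerDl sumr_ge0 // => i _; exact: sqr_ge0.
(* Minimality of [p'] tested against [p] forces the extra sum of squares to be at most 0, so [p']
   and [p] agree at every node. *)
move=> p' [p'A /(_ p pA)]; rewrite (pyth _ p'A) gerDl => le0.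
have sq_ge0 i : true -> 0 <= (p' (x i) - p (x i)) ^+ 2 by rewrite sqr_ge0.
have /eqP : \sum_(i < N) (p' (x i) - p (x i)) ^+ 2 = 0.
  by apply/le_anti; rewrite le0 sumr_ge0.
rewrite psumr_eq0 // => /allP eq0.
apply/esym/eqP; rewrite -subr_eq0; apply/eqP.
apply: (sph_poly_eq0_on_nodes _ _ x b) => //.
  by have [] := interpolatingB _ _ _ _ _ p'A pA.
move=> i; apply/eqP; rewrite -sqrf_eq0; exact: eq0 (mem_index_enum i).
Qed.

(** The set given to [xget] is then exactly the singleton of [p], which excludes the default value
    0. *)
Lemma interp_regr_eq (N M : nat) (x : 'I_N -> sphere R) (y : 'I_M -> sphere R)
    (f p : sphere R -> R) :
  unique (is_constrained_minimizer r x y f) p -> interp_regr r x y f = p.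
Proof.
move=> up; apply: xget_unique => // q [qmin _].
by case: up => _ /(_ _ qmin).
Qed.

End SphericalPolynomials.

Theorem theorem2 (R : realType) (m r n : nat)
  (lt_mr : (m < r)%N) (lt_rn : (r < n)%N)
  (x : 'I_(n.+1 ^ 2) -> sphere R) (y : 'I_(m.+1 ^ 2) -> sphere R)
  (x_inj : injective x) (y_inj : injective y)
  (y_sub_x : forall j, exists i, y j = x i)
  (b : 'I_(r.+1 ^ 2) -> sphere R -> R)
  (b_basis : is_basis b (sph_poly r))
  (rankN : \rank (vdm x b) = (r.+1 ^ 2)%N)
  (rankM : \rank (vdm y b) = (m.+1 ^ 2)%N)
  (f : sphere R -> R) :
  let phat := interp_regr r x y f in
  (forall q, vanishing r y q -> node_dot x (phat - f) q = 0)
  /\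
  [/\ interpolating r y f phat,
      forall q, vanishing r y q -> node_dot x (phat - f) q = 0
    & forall p, interpolating r y f p ->
        (forall q, vanishing r y q -> node_dot x (p - f) q = 0) ->
        p = phat].
Proof.
move=> phat.
have unique_min p := orthogonal_unique_minimizer R r _ _ _ x y b f p b_basis rankN.
have [p0 p0A p0_orth] :=
  interpolating_orthogonal_exists R r _ _ x b b_basis _ y f rankM.
have -> : phat = p0 by apply/interp_regr_eq/unique_min.
split=> //; split=> // p pA p_orth.
(* The orthogonal interpolant [p] is itself the unique minimizer, and [p0] is a minimizer. *)
by case: (unique_min p pA p_orth) => _; apply; case: (unique_min p0 p0A p0_orth).
Qed.
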